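(* Let $n$ be a positive integer, let $1\le i,j<n$ be integers, and let $l=\operatorname{trc}(i,j)$. As $(h_{i',j'})_{0\le i',j'\le n}$ ranges over all height functions of degree $n$, there are exactly $l+1$ possible values for the $(i,j)$-entry $h_{i,j}$, namely: (i) if $i=l$ and $l\le j\le n-l$, the values $(j-l)+2k$ for $0\le k\le l$; if $l\le i\le n-l$ and $j=l$, the values $(i-l)+2k$ for $0\le k\le l$; (ii) if $l\le i\le n-l$ and $j=n-l$, the values $(n-l-i)+2k$ for $0\le k\le l$; if $i=n-l$ and $l\le j\le n-l$, the values $(n-l-j)+2k$ for $0\le k\le l$.
   Context: A height function of degree $n$ is an $(n+1)\times(n+1)$ matrix $(h_{i,j})_{0\le i,j\le n}$ such that $|h_{i+1,j}-h_{i,j}|=1$ for $0\le i<n$, $0\le j\le n$; $|h_{i,j+1}-h_{i,j}|=1$ for $0\le i\le n$, $0\le j<n$; and $h_{i,0}=h_{0,i}=h_{n-i,n}=h_{n,n-i}=i$ for $0\le i\le n$. For $1\le i,j<n$ the track of $(i,j)$ is $\operatorname{trc}(i,j):=\min\{i,\,n-i,\,j,\,n-j\}$. *)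

(* Defs.v *)
From mathcomp Require Import all_boot all_order all_algebra.
From mathcomp Require Import classical_sets cardinality.

Set Implicit Arguments.
Unset Strict Implicit.
Unset Printing Implicit Defensive.

Local Open Scope ring_scope.
Local Open Scope classical_set_scope.

(* The adjacency and boundary conditions force the entries to be integers,
   hence the coefficient type [int].  In the boundary conditions [rev_ord i]
   is the index n - i and [ord_max] is the index n. *)
Definition height_function (n : nat) (h : 'M[int]_n.+1) : Prop :=
  [/\ forall i i' j : 'I_n.+1, i' = i.+1 :> nat -> `|h i' j - h i j| = 1,
      forall i j j' : 'I_n.+1, j' = j.+1 :> nat -> `|h i j' - h i j| = 1
    & forall i : 'I_n.+1,
        [/\ h i ord0 = i%:Z, h ord0 i = i%:Z,
            h (rev_ord i) ord_max = i%:Z & h ord_max (rev_ord i) = i%:Z]].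

Definition trc (n i j : nat) : nat :=
  minn (minn i (n - i)) (minn j (n - j)).

Definition entry_values (n : nat) (i j : 'I_n.+1) : set int :=
  [set h i j | h in [set h | height_function h]].

(* Main.v *)
Require Import Defs.
From mathcomp Require Import all_boot all_order all_algebra.
From mathcomp Require Import classical_sets cardinality.
From mathcomp Require Import zify.

(** The entry [h i j] is bounded by walking to it along its row or its column
from each of the four sides, where the values are prescribed: a walk with steps
+1 or -1 changes the value by at most its length, and by an amount of the parity
of its length ([walk_value]).  The four walks together give
  [`|i - j| <= h i j <= minn (i + j) (2 * n - i - j)],
with [h i j] of the parity of [i + j].  The two bounds are themselves height
functions, and they differ by exactly [2 * trc n i j], so at most [trc n i j + 1]
values remain ([height_function_entry]).

Conversely, let [v] be a value of the right parity between the bounds at a given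
position.  The function that alternates between [v] and [v + 1] on the two
parity classes of positions has steps +1 or -1, and clamping it between the
minimal and the maximal height functions keeps this property, since all three
functions have the parity of [i + j] at [(i, j)] ([clamp_step]).  On the boundary
the two bounds coincide with the prescribed values, so the clamped function is a
height function ([clamp_height_function]), and it takes the value [v] at the
given position ([clamp_id]).

Hence the set of values is [`|i - j| + 2 * k] for [k <= trc n i j]
([entry_valuesE]), and the four descriptions in the theorem are this one with
[`|i - j|] rewritten in each region. *)

Set Implicit Arguments.
Unset Strict Implicit.
Unset Printing Implicit Defensive.

Local Open Scope ring_scope.
Local Open Scope classical_set_scope.
Local Open Scope card_scope.

(** * Bounds on an entry *)

(** In the conclusion [k] is the number of up-steps on the way from [p] to [q]. *)
Lemma walk_value (n : nat) (f : 'I_n.+1 -> int) (p q : 'I_n.+1) :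
    (forall i i' : 'I_n.+1, i' = i.+1 :> nat -> `|f i' - f i| = 1) ->
    (p <= q)%N ->
  exists2 k : nat, (k <= q - p)%N & f q = f p - (q - p)%N%:Z + 2 * k%:Z.
Proof.
move=> step le_pq.
suff walk m (r : 'I_n.+1) : r = (p + m)%N :> nat ->
    exists2 k : nat, (k <= m)%N & f r = f p - m%:Z + 2 * k%:Z.
  by apply: walk; rewrite subnKC.
elim: m r => [|m IHm] r r_eq.
  by exists 0%N => //; have -> : r = p by [apply: val_inj => /=; lia]; lia.
have lt_pm : (p + m < n.+1)%N by have := ltn_ord r; lia.
have [k le_km fk] := IHm (Ordinal lt_pm) erefl.
have := step (Ordinal lt_pm) r; rewrite /= => /(_ ltac:(lia)) fr.
have [up|down] : f r = f (Ordinal lt_pm) + 1 \/ f r = f (Ordinal lt_pm) - 1.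
  by lia.
- by exists k.+1; lia.
- by exists k; lia.
Qed.

(** For a position in one of the four triangles cut out by the diagonals, the
lower bound comes from the left or the top side.  The upper bound [k <= trc n i j]
comes from the side nearest to the position: if this is the left or the top side,
it is the bound on the number of up-steps of the same walk; otherwise it comes
from the walk on to the right or the bottom side. *)
Lemma height_function_entry (n : nat) (h : 'M[int]_n.+1) (i j : 'I_n.+1) :
    height_function h ->
  exists2 k : nat, (k <= trc n i j)%N & h i j = `|i%:Z - j%:Z| + 2 * k%:Z.
Proof.
move=> [stepi stepj bdry].
have [lt_in lt_jn] := (ltn_ord i, ltn_ord j).
have [le_ij|lt_ji] := leqP i j; have [le_sum|gt_sum] := leqP (i + j) n.
- have [_ top_j _ _] := bdry j.
  have [k] := @walk_value n (h^~ j) ord0 i (fun x y => @stepi x y j) (leq0n i).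
  rewrite top_j /= => le_k h_ij; exists k; last by lia.
  by rewrite /trc; lia.
- have [_ top_j _ _] := bdry j; have [_ _ right_i _] := bdry (rev_ord i).
  rewrite rev_ordK /= in right_i.
  have [k] := @walk_value n (h^~ j) ord0 i (fun x y => @stepi x y j) (leq0n i).
  have [m] := @walk_value n (h i) j ord_max (stepj i) (leq_ord j).
  rewrite top_j right_i /= => le_m h_ij le_k h_ij'; exists k; last by lia.
  by rewrite /trc; lia.
- have [left_i _ _ _] := bdry i.
  have [k] := @walk_value n (h i) ord0 j (stepj i) (leq0n j).
  rewrite left_i /= => le_k h_ij; exists k; last by lia.
  by rewrite /trc; lia.
- have [left_i _ _ _] := bdry i; have [_ _ _ bot_j] := bdry (rev_ord j).
  rewrite rev_ordK /= in bot_j.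
  have [k] := @walk_value n (h i) ord0 j (stepj i) (leq0n j).
  have [m] := @walk_value n (h^~ j) i ord_max
    (fun x y => @stepi x y j) (leq_ord i).
  rewrite left_i bot_j /= => le_m h_ij le_k h_ij'; exists k; last by lia.
  by rewrite /trc; lia.
Qed.

(** * Height functions with a prescribed entry *)

(** The minimum and the maximum cannot stay constant in a step, because their
parity is the common parity of the arguments, which changes. *)
Lemma maxn_step (x x' y y' : nat) :
    odd x = odd y -> `|x'%:Z - x%:Z| = 1 -> `|y'%:Z - y%:Z| = 1 ->
  `|(maxn x' y')%:Z - (maxn x y)%:Z| = 1.
Proof. by move=> odd_xy stepx stepy; case: (leqP x y); case: (leqP x' y'); lia. Qed.

Lemma minn_step (x x' y y' : nat) :
    odd x = odd y -> `|x'%:Z - x%:Z| = 1 -> `|y'%:Z - y%:Z| = 1 ->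
  `|(minn x' y')%:Z - (minn x y)%:Z| = 1.
Proof. by move=> odd_xy stepx stepy; case: (leqP x y); case: (leqP x' y'); lia. Qed.

(** This is the distance between [i] and [j], as the subtractions are truncated. *)
Definition min_height (i j : nat) : nat := (i - j) + (j - i).

Definition max_height (n i j : nat) : nat := minn (i + j) (2 * n - (i + j)).

(** The summand [odd _] makes the innermost function alternate between [v] and
[v + 1]: it thus has the parity of [i + j], as the two bounds do, and steps +1
or -1. *)
Definition clamp (n v i j : nat) : nat :=
  maxn (min_height i j) (minn (max_height n i j) (v + odd (v + i + j))).

Lemma clampC (n v i j : nat) : clamp n v i j = clamp n v j i.
Proof.
by rewrite /clamp /min_height /max_height addnC (addnC i) addnAC.
Qed.

Lemma odd_min_height (i j : nat) : odd (min_height i j) = odd (i + j).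
Proof. by rewrite /min_height; lia. Qed.

Lemma odd_max_height (n i j : nat) :
  (i <= n)%N -> (j <= n)%N -> odd (max_height n i j) = odd (i + j).
Proof.
by move=> le_in le_jn; rewrite /max_height; case: leqP => // _; lia.
Qed.

Lemma odd_alternating (v i j : nat) : odd (v + odd (v + i + j)) = odd (i + j).
Proof. by rewrite !oddD oddb; case: (odd v); case: (odd i); case: (odd j). Qed.

Lemma clamp_step (n v i j : nat) :
    (i < n)%N -> (j <= n)%N ->
  `|(clamp n v i.+1 j)%:Z - (clamp n v i j)%:Z| = 1.
Proof.
move=> lt_in le_jn; have le_in := ltnW lt_in.
have odd_eq : odd (max_height n i j) = odd (v + odd (v + i + j)).
  by rewrite odd_max_height // odd_alternating.
apply: maxn_step.
- rewrite odd_min_height; case: leqP => _ //.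
    by rewrite odd_max_height.
  by rewrite odd_alternating.
- by rewrite /min_height; lia.
apply: minn_step => //.
  by apply: minn_step; lia.
by rewrite addnS addSn /=; case: (odd (v + i + j)); lia.
Qed.

Lemma clamp_id (n v i j : nat) :
    (min_height i j <= v <= max_height n i j)%N -> odd v = odd (i + j) ->
  clamp n v i j = v.
Proof.
move=> /andP[le_min le_max] odd_v.
rewrite /clamp -addnA oddD odd_v addbb addn0.
by rewrite (minn_idPr le_max) (maxn_idPr le_min).
Qed.

Lemma clamp_height_function (n v : nat) :
  height_function (\matrix_(i < n.+1, j < n.+1) (clamp n v i j)%:Z).
Proof.
split=> [i i' j i'_eq|i j j' j'_eq|i].
- rewrite !mxE i'_eq clamp_step //; last by have := ltn_ord j; lia.
  by have := ltn_ord i'; lia.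
- rewrite !mxE j'_eq 2!(clampC n v i) clamp_step //; last by have := ltn_ord i; lia.
  by have := ltn_ord j'; lia.
- have := ltn_ord i; rewrite !mxE /clamp /min_height /max_height /= => lt_in.
  by split; lia.
Qed.

(** * The set of values of an entry *)

Lemma entry_valuesE (n : nat) (i j : 'I_n.+1) :
  entry_values i j =
    [set `|i%:Z - j%:Z| + 2 * k%:Z | k in [set k : nat | (k <= trc n i j)%N]].
Proof.
apply/seteqP; split=> [_ [h hP <-]|_ [k /= le_k <-]].
  by have [k le_k ->] := height_function_entry i j hP; exists k.
pose v := (min_height i j + 2 * k)%N.
exists (\matrix_(i0 < n.+1, j0 < n.+1) (clamp n v i0 j0)%:Z).
  exact: clamp_height_function.
have [le_in le_jn] := (leq_ord i, leq_ord j).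
rewrite mxE clamp_id /v; first by rewrite /min_height; lia.
  rewrite leq_addr /max_height leq_min /min_height.
  by move: le_k; rewrite /trc !leq_min => /andP[/andP[? ?] /andP[? ?]]; lia.
by rewrite oddD odd_min_height oddM addbF.
Qed.

Theorem proposition3p3 (n : nat) (i j : 'I_n.+1) (l : nat)
    (n_gt0 : (0 < n)%N) (i_int : (1 <= i < n)%N) (j_int : (1 <= j < n)%N)
    (l_trc : l = trc n i j) :
  entry_values i j #= `I_l.+1 /\
  (((i = l :> nat) -> (l <= j <= n - l)%N ->
      entry_values i j =
        [set (j%:Z - l%:Z) + 2 * k%:Z | k in [set k : nat | (k <= l)%N]]) /\
   ((l <= i <= n - l)%N -> (j = l :> nat) ->
      entry_values i j =
        [set (i%:Z - l%:Z) + 2 * k%:Z | k in [set k : nat | (k <= l)%N]])) /\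
  (((l <= i <= n - l)%N -> (j = n - l :> nat)%N ->
      entry_values i j =
        [set (n%:Z - l%:Z - i%:Z) + 2 * k%:Z | k in [set k : nat | (k <= l)%N]]) /\
   ((i = n - l :> nat)%N -> (l <= j <= n - l)%N ->
      entry_values i j =
        [set (n%:Z - l%:Z - j%:Z) + 2 * k%:Z | k in [set k : nat | (k <= l)%N]])).
Proof.
rewrite entry_valuesE -l_trc; split.
  by apply: inj_card_eq => k k' _ _; lia.
have image_ext (b c : int) : b = c ->
    [set b + 2 * k%:Z | k in [set k : nat | (k <= l)%N]] =
    [set c + 2 * k%:Z | k in [set k : nat | (k <= l)%N]] by move->.
by split; split=> ? ?; apply: image_ext; lia.
Qed.
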